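(* Let $p, x \ge 2$ be integers with $(p,x) \neq (2,2)$, and let \[ S = \langle p^x - 2,\ 2(p^x-2)+1,\ 2(p^x-2)+p,\ \ldots,\ 2(p^x-2)+p^{x-1} \rangle \] be the numerical semigroup whose $x+1$ generators are $p^x-2$ and $2(p^x-2)+p^{i-1}$ for $1 \le i \le x$. Then \[ \Delta(S) = \{p-1,\ (p-1)x\}. \]
   Context: $\mathbb{N} = \{0,1,2,\ldots\}$. A numerical semigroup is an additive submonoid $S$ of $\mathbb{N}$ with finite complement. Every numerical semigroup has a unique minimal generating set $\{n_1,\ldots,n_e\}$ (positive integers), and $S = \langle n_1,\ldots,n_e\rangle$ means that $\{n_1,\ldots,n_e\}$ is the minimal generating set of $S$. All factorizations are taken with respect to the minimal generating set. A factorization of $y \in S$ is a tuple $(a_1,\ldots,a_e) \in \mathbb{N}^e$ with $a_1 n_1 + \cdots + a_e n_e = y$; its length is $a_1+\cdots+a_e$. Let $\mathcal{L}(y) = \{\ell_1 < \ell_2 < \cdots < \ell_m\}$ be the (finite) set of lengths of factorizations of $y$. The delta set of $y$ is $\Delta(y) = \{\ell_{i+1}-\ell_i : 1 \le i \le m-1\}$, and the delta set of $S$ is $\Delta(S) = \bigcup_{y \in S} \Delta(y)$. *)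

(* Defs.v *)
From HB Require Import structures.
From mathcomp Require Import all_boot finmap.
From mathcomp Require Import boolp classical_sets functions cardinality.

Set Implicit Arguments.
Unset Strict Implicit.
Unset Printing Implicit Defensive.

Local Open Scope classical_set_scope.
Local Open Scope nat_scope.

Definition numerical_semigroup (S : set nat) : Prop :=
  [/\ S 0, forall a b, S a -> S b -> S (a + b) & finite_set (~` S)].

(* A tuple of coefficients indexed by the generators is a finite function on
   the finite set A of generators. *)
Definition factorizations (A : {fset nat}) (y : nat) : set {ffun A -> nat} :=
  [set a | \sum_(n : A) a n * val n = y].
Arguments factorizations A y : clear implicits.

Definition factorization_length (A : {fset nat}) (a : {ffun A -> nat}) : nat :=
  \sum_(n : A) a n.

Definition generated_by (A : {fset nat}) : set nat :=
  [set y | exists a, factorizations A y a].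

Definition minimal_generating_set (S : set nat) (A : {fset nat}) : Prop :=
  generated_by A = S /\
  forall B : {fset nat}, (B `<` A)%fset -> generated_by B <> S.

(* The quantifier over A does not range over different choices of generators:
   a numerical semigroup has exactly one minimal generating set. *)
Definition length_set (S : set nat) (y : nat) : set nat :=
  [set l | exists A : {fset nat}, minimal_generating_set S A /\
     exists2 a, factorizations A y a & factorization_length a = l].

Definition delta_set_of (S : set nat) (y : nat) : set nat :=
  [set d | exists s : seq nat,
     [/\ sorted ltn s, [set` s] = length_set S y &
         exists2 i, i.+1 < size s & d = nth 0 s i.+1 - nth 0 s i]].

Definition delta_set (S : set nat) : set nat :=
  \bigcup_(y in S) delta_set_of S y.

Definition generators (p x : nat) : {fset nat} :=
  let n := p ^ x - 2 in
  (n |` [fset (2 * n + p ^ (i - 1))%N | i in iota 1 x])%fset.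

(* Main.v *)
Require Import Defs.
From HB Require Import structures.
From mathcomp Require Import all_boot finmap.
From mathcomp Require Import boolp classical_sets functions cardinality.
From mathcomp Require Import zify.

Local Open Scope classical_set_scope.
Local Open Scope nat_scope.

(** Write N = p ^ x - 2 and n = x - 1.  A factorization of y that uses a copies
    of N and B generators 2 N + p ^ i, with v the sum of those p ^ i, satisfies
    y = k N + v where k = a + 2 B, and has length a + B = k - B.  So only k and
    the number B of powers of p in a decomposition of v matter, and such a
    pair comes from a factorization exactly when 2 B <= k.

    For fixed v the possible B are v - (p - 1) e with 0 <= e <= E v, where
    E v is the sum of the quotients v %/ p ^ i for 1 <= i <= n: trading p
    copies of p ^ i for one p ^ i.+1 lowers B by p - 1, and E v counts the
    trades made on the way from v ones to the greedy decomposition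
    ([sum_of_generatorsP]).  Each k thus contributes a block of lengths in
    arithmetic progression with step p - 1.

    All the lengths of y are congruent modulo p - 1, so each can be replaced by
    its position s, larger for shorter lengths.  Lowering k by one replaces v
    by v + N, and
      E (v + N) + C v + 1 = E v + (p ^ x - 1) / (p - 1),
    where C v counts the 1 <= i <= n with v mod p ^ i <= 1
    ([legendre_shift]).  In terms of positions, the next block starts C v + 1
    later than the current one, which has E v + 1 places
    ([sum_of_generators_blockP]).  If v >= 2 then C v <= E v, since
    v mod p ^ i <= 1 forces p ^ i <= v: consecutive blocks touch or overlap.
    If v <= 1 then E v = 0 and C v = n, so the two starts differ by n + 1 = x;
    this only happens for the largest k.

    The condition 2 B <= k, which reads k <= 2 l for the length l, removes the
    shortest lengths of the blocks.  Since positions grow at least as fast as k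
    decreases, going back from a length in a later block to a position of an
    earlier one raises l by at least as much as k; so whatever precedes a
    length that meets the condition meets it too, and no hole is created.
    Hence every gap is p - 1 or (p - 1) x ([length_gaps]).  The first occurs for
    2 p N + p = p (2 N + 1), the second for a large multiple of N.  The atoms
    of the semigroup are read off from sizes: all generators are less than 3 N,
    while a sum of two of them is 2 N or at least 3 N. *)

(** * Factorizations as lists, and atoms *)

(** Up to order, a list of elements of A is a family of multiplicities, that is
    a factorization; lists allow induction on the length. *)
Definition sum_of_length (A : {fset nat}) (y l : nat) : Prop :=
  exists s : seq nat, [/\ {subset s <= A}, sumn s = y & size s = l].

(** From lists to finite functions one counts occurrences; from finite functions
    to lists one repeats each generator as often as prescribed. *)
Lemma sum_of_lengthP (A : {fset nat}) (y l : nat) :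
  (exists2 a, factorizations A y a & factorization_length a = l) <->
  sum_of_length A y l.
Proof.
split=> [[a ya al]|[s [sA <- <-]]].
- exists (flatten [seq nseq (a i) (val i) | i <- index_enum A]); split.
  + move=> z /flattenP[_ /mapP[i _ ->]] /nseqP[-> _]; exact: valP.
  + rewrite sumn_flatten -map_comp sumnE big_map /= -ya.
    by apply: eq_bigr => i _; rewrite sumn_nseq mulnC.
  + rewrite size_flatten /shape -map_comp sumnE big_map /= -al.
    by apply: eq_bigr => i _; rewrite size_nseq.
- (* grouping a sum over the entries of s by their value covers both the sum of
     the entries (f the identity) and their number (f constant) *)
  have keyed (f : nat -> nat) :
      \sum_(i : A) count_mem (val i) s * f (val i) = \sum_(z <- s) f z.
    elim: s sA => [|z s IHs] sA; first by rewrite big_nil big1.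
    have zA : z \in A by apply: sA; rewrite mem_head.
    rewrite big_cons -IHs; last by move=> w ws; apply: sA; rewrite inE ws orbT.
    rewrite /=; under eq_bigr => i _ do rewrite mulnDl.
    rewrite big_split /=; congr (_ + _).
    rewrite (bigD1 [` zA]%fset) //= eqxx mul1n big1 ?addn0 // => i.
    by rewrite -val_eqE /= eq_sym => /negbTE->.
  exists [ffun i : A => count_mem (val i) s].
  + rewrite /factorizations /= sumnE -(keyed id).
    by apply: eq_bigr => i _; rewrite ffunE.
  + rewrite -sum1_size -(keyed (fun=> 1)).
    by apply: eq_bigr => i _; rewrite ffunE muln1.
Qed.

Lemma generated_byP (A : {fset nat}) (y : nat) :
  generated_by A y <-> exists l, sum_of_length A y l.
Proof.
split=> [[a ya]|[l /sum_of_lengthP[a ya _]]]; last by exists a.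
by exists (factorization_length a); apply/sum_of_lengthP; exists a.
Qed.

Lemma generated_by0 (A : {fset nat}) : generated_by A 0.
Proof. by apply/generated_byP; exists 0, [::]. Qed.

Lemma generated_byD (A : {fset nat}) (a b : nat) :
  generated_by A a -> generated_by A b -> generated_by A (a + b).
Proof.
move=> /generated_byP[_ [s [sA <- _]]] /generated_byP[_ [t [tA <- _]]].
apply/generated_byP; exists (size (s ++ t)), (s ++ t); split=> //.
  by move=> z; rewrite mem_cat => /orP[/sA|/tA].
by rewrite sumn_cat.
Qed.

Lemma sub_generated_by (A : {fset nat}) (g : nat) :
  g \in A -> generated_by A g.
Proof.
move=> gA; apply/generated_byP; exists 1, [:: g]; split=> //=.
  by move=> z; rewrite inE => /eqP->.
by rewrite addn0.
Qed.

Definition atom (S : set nat) (g : nat) : Prop :=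
  g != 0 /\ forall a b, S a -> S b -> a + b = g -> a = 0 \/ b = 0.

(** Peeling entries off a list that sums to an atom: at each step either the
    entry is 0 and can be dropped, or it is the atom. *)
Lemma atom_mem (A : {fset nat}) (g : nat) :
  generated_by A g -> atom (generated_by A) g -> g \in A.
Proof.
move=> /generated_byP[l [s [sA sg _]]] [g0 gat].
elim: s sA sg => [|z s IHs] sA /= sg; first by rewrite -sg eqxx in g0.
have zA : z \in A by apply: sA; rewrite mem_head.
have sA' : {subset s <= A} by move=> w ws; apply: sA; rewrite inE ws orbT.
have Ss : generated_by A (sumn s).
  by apply/generated_byP; exists (size s), s.
case: (gat _ _ (sub_generated_by _ _ zA) Ss sg) => [z0|s0].
  by apply: IHs; rewrite // -sg z0.
by rewrite -sg s0 addn0.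
Qed.

(** Every generating set contains all atoms, so a generating set that consists
    of atoms lies inside every other one. *)
Lemma minimal_generating_set_atoms (G A : {fset nat}) :
  (forall g, g \in G -> atom (generated_by G) g) ->
  minimal_generating_set (generated_by G) A <-> A = G.
Proof.
move=> Gat.
have subG B : generated_by B = generated_by G -> (G `<=` B)%fset.
  move=> BG; apply/fsubsetP => g gG; apply: atom_mem; rewrite BG.
    exact: sub_generated_by.
  exact: Gat.
split=> [[AG Amin]|->].
  apply/eqP; apply: contrapT => /negP AnG; apply: (Amin G) => //.
  by rewrite fproperEneq eq_sym AnG subG.
split=> // B BG /subG GB.
by move: BG; rewrite fproperE GB andbF.
Qed.

(** The quantification over minimal generating sets disappears because there is
    only one of them. *)
Lemma length_set_atoms (G : {fset nat}) (y : nat) :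
  (forall g, g \in G -> atom (generated_by G) g) ->
  length_set (generated_by G) y = [set l | sum_of_length G y l].
Proof.
move=> Gat; apply/seteqP; split=> l /=.
  by move=> [A [/minimal_generating_set_atoms -> // /sum_of_lengthP]].
move=> /sum_of_lengthP yl; exists G; split=> //.
exact/minimal_generating_set_atoms.
Qed.

(** * Delta sets through consecutive lengths *)

(** The increasing enumeration of a bounded length set can be avoided: its
    consecutive entries are the pairs of lengths with no length between them. *)
Lemma delta_set_ofP (S : set nat) (y d b : nat) :
  (forall l, length_set S y l -> l <= b) ->
  delta_set_of S y d <->
  exists l m, [/\ length_set S y l, length_set S y m, l < m, d = m - l &
    forall k, length_set S y k -> k <= l \/ m <= k].
Proof.
move=> Lb; split.
- move=> [s [s_sorted sL [i ilt ->]]].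
  have sP k : length_set S y k <-> k \in s by rewrite -sL.
  exists (nth 0 s i), (nth 0 s i.+1); split=> //.
  + by apply/sP; rewrite mem_nth // ltnW.
  + by apply/sP; rewrite mem_nth.
  + by rewrite (sorted_ltn_nth ltn_trans) // inE // ltnW.
  + move=> k /sP /(nthP 0)[j jlt <-].
    have leqs := sorted_leq_nth leq_trans leqnn 0 (sub_sorted ltnW s_sorted).
    case: (leqP j i) => ij; [left|right]; apply: leqs => //; rewrite inE //.
    exact: ltnW.
- move=> [l [m [Ll Lm lm -> nob]]].
  pose s := [seq k <- iota 0 b.+1 | `[< length_set S y k >]].
  have sP k : length_set S y k <-> k \in s.
    rewrite mem_filter mem_iota add0n ltnS /=.
    split; last by case/andP=> /asboolP.
    by move=> Lk; rewrite Lb // andbT; apply/asboolP.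
  have s_sorted : sorted ltn s.
    by apply: sorted_filter (iota_ltn_sorted _ _); exact: ltn_trans.
  exists s; split=> //; first by apply/seteqP; split=> k /= /sP.
  have lt_nth := sorted_ltn_nth ltn_trans 0 s_sorted.
  have le_nth := sorted_leq_nth leq_trans leqnn 0 (sub_sorted ltnW s_sorted).
  have li : index l s < size s by rewrite index_mem; apply/sP.
  have mi : index m s < size s by rewrite index_mem; apply/sP.
  have l_nth : nth 0 s (index l s) = l by rewrite nth_index //; apply/sP.
  have m_nth : nth 0 s (index m s) = m by rewrite nth_index //; apply/sP.
  have ilm : index l s < index m s.
    rewrite ltnNge; apply/negP => /(le_nth _ _ mi li).
    by rewrite l_nth m_nth leqNgt lm.
  have i1 : (index l s).+1 < size s by exact: leq_ltn_trans ilm mi.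
  exists (index l s) => //; congr (_ - _); last by rewrite l_nth.
  have lnext := lt_nth _ _ li i1 (ltnSn _).
  have nextm := le_nth _ _ i1 mi ilm.
  have := nob (nth 0 s (index l s).+1).
  rewrite sP mem_nth // => /(_ isT).
  by rewrite l_nth m_nth in lnext nextm *; lia.
Qed.

(** * Sums of powers of p *)

(** For p prime and v < p ^ n.+1 this is the p-adic valuation of the factorial
    of v, by Legendre's formula.  In general, p - 1 times it is v minus the
    least number of powers p ^ i, i <= n, with sum v. *)
Definition legendre (p n v : nat) : nat := \sum_(i < n) v %/ p ^ i.+1.

(** The loss of legendre when 2 is subtracted from v >= 2: exactly the quotients
    v %/ p ^ i.+1 counted here drop by one. *)
Definition carry_loss (p n v : nat) : nat := \sum_(i < n) (v %% p ^ i.+1 <= 1).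

(** The sum of the powers of p up to p ^ n, indexed by decreasing exponents so
    that its terms line up with those of legendre. *)
Definition geom_sum (p n : nat) : nat := \sum_(i < n.+1) p ^ (n - i).

Lemma legendreS (p n v : nat) :
  legendre p n.+1 v = v %/ p + legendre p n (v %/ p).
Proof.
rewrite /legendre big_ord_recl expn1; congr (_ + _).
by apply: eq_bigr => i _; rewrite -divnMA -expnS.
Qed.

Lemma legendreD (p n v w : nat) : 0 < p ->
  legendre p n v + legendre p n w <= legendre p n (v + w).
Proof.
move=> p_gt0; rewrite /legendre -big_split /=; apply: leq_sum => i _.
by rewrite divnD ?leq_addr // expn_gt0 p_gt0.
Qed.

Lemma geom_sumE (p n : nat) : 0 < p -> (p - 1) * geom_sum p n + 1 = p ^ n.+1.
Proof.
move=> p_gt0; have : 0 < p ^ n.+1 by rewrite expn_gt0 p_gt0.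
rewrite addn1 subn1 => /prednK <-; rewrite predn_exp /geom_sum.
rewrite (reindex_inj rev_ord_inj) /=; congr (_ * _).+1.
by apply: eq_bigr => i _; congr (_ ^ _); have := ltn_ord i; lia.
Qed.

Lemma legendre_pow (p n i : nat) : 1 < p -> i <= n ->
  (p - 1) * legendre p n (p ^ i) + 1 = p ^ i.
Proof.
move=> p_gt1; elim: n i => [|n IHn] [|i] // ilen.
- by rewrite /legendre big_ord0 muln0.
- rewrite /legendre expn0 big1 ?muln0 // => j _.
  by rewrite divn_small // -[1](expn0 p) ltn_exp2l.
- rewrite legendreS expnS mulKn; last exact: ltnW.
  by rewrite mulnDr -addnA IHn // -mulSnr subn1 prednK // ltnW.
Qed.

(** Termwise, adding p ^ n.+1 adds p ^ (n - i) to the quotient by p ^ i.+1, and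
    then subtracting 2 costs one exactly when the remainder is 0 or 1. *)
Lemma legendre_shift (p n v : nat) : 1 < p ->
  legendre p n (v + (p ^ n.+1 - 2)) + carry_loss p n v + 1 =
  legendre p n v + geom_sum p n.
Proof.
move=> p_gt1; rewrite /legendre /carry_loss /geom_sum.
rewrite big_ord_recr /= subnn expn0 addnA; congr (_ + 1).
rewrite -!big_split /=; apply: eq_bigr => i _.
have ilt := ltn_ord i.
set q := p ^ i.+1.
have q_gt1 : 1 < q by rewrite -(expn0 p) ltn_exp2l.
have -> : p ^ n.+1 = p ^ (n - i) * q by rewrite -expnD; congr (_ ^ _); lia.
have h_gt0 : 0 < p ^ (n - i) by rewrite expn_gt0 ltnW.
move: (p ^ (n - i)) h_gt0 => [//|h] _.
have -> : v + (h.+1 * q - 2) = (v %/ q + h) * q + (v %% q + q - 2).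
  by rewrite {1}(divn_eq v q); lia.
have rlt : v %% q < q by rewrite ltn_mod ltnW.
rewrite divnMDl; last exact: ltnW.
move: (v %/ q) (v %% q) rlt => c r rlt.
case: (leqP r 1) => r1 /=.
  by rewrite divn_small; lia.
have -> : r + q - 2 = 1 * q + (r - 2) by lia.
by rewrite divnMDl ?divn_small; lia.
Qed.

(** For v >= 2 a remainder of at most 1 modulo p ^ i.+1 differs from v, so the
    quotient is nonzero. *)
Lemma carry_loss_le_legendre (p n v : nat) : 0 < p -> 1 < v ->
  carry_loss p n v <= legendre p n v.
Proof.
move=> p_gt0 v_gt1; apply: leq_sum => i _.
case: (leqP (v %% p ^ i.+1) 1) => //= r1; rewrite divn_gt0 ?expn_gt0 ?p_gt0 //.
by rewrite leqNgt; apply/negP => lt; rewrite modn_small in r1; lia.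
Qed.

Lemma carry_loss_small (p n v : nat) : 1 < p -> v <= 1 -> carry_loss p n v = n.
Proof.
move=> p_gt1 v1; rewrite /carry_loss -[RHS]card_ord -sum1_card.
apply: eq_bigr => i _; rewrite modn_small ?v1 //.
by rewrite (leq_ltn_trans v1) // -(expn0 p) ltn_exp2l.
Qed.

Lemma legendre_small (p n v : nat) : 1 < p -> v <= 1 -> legendre p n v = 0.
Proof.
move=> p_gt1 v1; rewrite /legendre big1 // => i _; rewrite divn_small //.
by rewrite (leq_ltn_trans v1) // -(expn0 p) ltn_exp2l.
Qed.

(** Every number of trades of p equal powers for one higher power, from none to
    legendre p n v, is feasible.  Induction on n: part of the units are grouped
    into multiples of p, and the remaining trades take place among those. *)
Lemma sum_of_powers (p n v e : nat) : 1 < p -> e <= legendre p n v ->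
  exists s : seq nat, [/\ forall z, z \in s -> exists2 i, i <= n & z = p ^ i,
    sumn s = v & size s + (p - 1) * e = v].
Proof.
move=> p_gt1; elim: n v e => [|n IHn] v e.
  rewrite /legendre big_ord0 leqn0 => /eqP->.
  exists (nseq v 1); split; last by rewrite size_nseq muln0 addn0.
    by move=> z /nseqP[-> _]; exists 0.
  by rewrite sumn_nseq mul1n.
rewrite legendreS => ele.
(* w groups of p units each become a p; trades at higher levels start only
   once all v %/ p groups have been formed *)
have [w [e' [we e'le ->]]] : exists w e',
    [/\ w <= v %/ p, e' <= legendre p n w & e = w + e'].
  case: (leqP e (v %/ p)) => evp; first by exists e, 0; rewrite addn0.
  by exists (v %/ p), (e - v %/ p); split=> //; lia.
have [s [sP ss szs]] := IHn w e' e'le.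
have pwv : p * w <= v.
  by rewrite mulnC (leq_trans _ (leq_divM v p)) // leq_mul2r we orbT.
exists (nseq (v - p * w) 1 ++ map (muln p) s); split.
- move=> z; rewrite mem_cat => /orP[/nseqP[-> _]|/mapP[y /sP[i ilen ->] ->]].
    by exists 0.
  by exists i.+1; rewrite ?expnS.
- rewrite sumn_cat sumn_nseq mul1n.
  suff -> : sumn (map (muln p) s) = p * w by rewrite subnK.
  by rewrite -ss; elim: (s) => [|z t IHt] /=; rewrite ?muln0 // mulnDr IHt.
- rewrite size_cat size_nseq size_map mulnDr.
  have : p * w = (p - 1) * w + w by rewrite -mulSnr subn1 prednK // ltnW.
  by lia.
Qed.

(** * The lengths of an element *)

Lemma in_generators (p n z : nat) :
  z \in generators p n.+1 <->
  z = p ^ n.+1 - 2 \/ exists2 i, i <= n & z = 2 * (p ^ n.+1 - 2) + p ^ i.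
Proof.
rewrite /generators in_fset1U; split.
  case/orP=> [/eqP->|/imfsetP[i /=]]; first by left.
  rewrite (mem_iota 1 n.+1) => ilt ->; right; exists (i - 1) => //; lia.
case=> [->|[i ilt ->]]; first by rewrite eqxx.
apply/orP; right; apply/imfsetP; exists i.+1; last by rewrite subn1.
by rewrite /= (mem_iota 1 n.+1); lia.
Qed.

(** Here k is the number of copies of p ^ n.+1 - 2, each generator
    2 (p ^ n.+1 - 2) + p ^ i providing two of them, and v is the rest.  With
    B = v - (p - 1) e generators of that kind, the length is l = k - B, and
    k <= 2 l says that k - 2 B, the multiplicity of p ^ n.+1 - 2, is not
    negative. *)
Lemma sum_of_generatorsP (p n y l : nat) : 1 < p ->
  sum_of_length (generators p n.+1) y l <->
  exists k v e, [/\ y = k * (p ^ n.+1 - 2) + v, e <= legendre p n v,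
    l + v = k + (p - 1) * e & k <= 2 * l].
Proof.
move=> p_gt1; set N := p ^ n.+1 - 2; split.
- move=> [s [sG <- <-]] {y l}; elim: s sG => [|z s IHs] sG.
    by exists 0, 0, 0; rewrite muln0.
  have [|k [v [e [/= -> ele lv kl]]]] := IHs.
    by move=> w ws; apply: sG; rewrite inE ws orbT.
  have /in_generators[->|[i ile ->]] := sG z (mem_head _ _).
    exists k.+1, v, e; split=> //; rewrite -?/N; lia.
  exists k.+2, (v + p ^ i), (e + legendre p n (p ^ i)); split.
  + rewrite -/N; lia.
  + by apply: leq_trans (legendreD _ _ _ _ (ltnW p_gt1)); rewrite leq_add2r.
  + have := legendre_pow _ _ _ p_gt1 ile; rewrite mulnDr; lia.
  + lia.
- move=> [k [v [e [-> ele lv kl]]]].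
  have [s [sP ss szs]] := sum_of_powers _ _ _ _ p_gt1 ele.
  exists (nseq (k - 2 * size s) N ++ map (addn (2 * N)) s); split.
  + move=> z; rewrite mem_cat => zs; apply/in_generators.
    case/orP: zs => [/nseqP[-> _]|/mapP[w /sP[i ilen ->] ->]]; first by left.
    by right; exists i.
  + rewrite sumn_cat sumn_nseq.
    have -> : sumn (map (addn (2 * N)) s) = size s * (2 * N) + sumn s.
      by elim: (s) => //= z t ->; lia.
    rewrite ss addnA; congr (_ + _).
    have ks : 2 * size s <= k by lia.
    by rewrite -{2}(subnK ks) mulnDl; lia.
  + rewrite size_cat size_nseq size_map; lia.
Qed.

(** * Blocks of lengths *)

(** Lengths of k0 (p ^ n.+1 - 2) + r are numbered downwards in steps of p - 1,
    starting at position 0 with the largest value allowed by k = k0.  This is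
    the position of the first, hence longest, length of the block
    k = k0 - j. *)
Definition block_start (p n r j : nat) : nat :=
  \sum_(i < j) (carry_loss p n (r + i * (p ^ n.+1 - 2)) + 1).

Lemma block_startS (p n r j : nat) :
  block_start p n r j.+1 =
  block_start p n r j + carry_loss p n (r + j * (p ^ n.+1 - 2)) + 1.
Proof. by rewrite /block_start big_ord_recr /= addnA. Qed.

Lemma block_start_gap (p n r i j : nat) : i <= j ->
  block_start p n r i + (j - i) <= block_start p n r j.
Proof.
move=> ij; rewrite -{2}(subnKC ij); elim: (j - i) => [|d IHd].
  by rewrite !addn0.
by rewrite !addnS block_startS; lia.
Qed.

(** The last position of block j, where no trade is made and so B = v.  It moves
    by geom_sum p n = (p ^ n.+1 - 1) / (p - 1) per block, because lowering k by
    one raises v by p ^ n.+1 - 2. *)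
Lemma block_end (p n r j : nat) : 1 < p ->
  block_start p n r j + legendre p n (r + j * (p ^ n.+1 - 2)) =
  legendre p n r + j * geom_sum p n.
Proof.
move=> p_gt1; elim: j => [|j IHj].
  by rewrite /block_start big_ord0 !addn0.
rewrite block_startS mulSn (addnC (p ^ n.+1 - 2)) addnA.
have := legendre_shift p n (r + j * (p ^ n.+1 - 2)) p_gt1.
by rewrite mulSn; lia.
Qed.

(** The change of variables k = k0 - j, v = r + j (p ^ n.+1 - 2), and
    s = legendre p n r + j * geom_sum p n - e. *)
Lemma sum_of_generators_blockP (p n k0 r l : nat) : 1 < p ->
  r < p ^ n.+1 - 2 ->
  sum_of_length (generators p n.+1) (k0 * (p ^ n.+1 - 2) + r) l <->
  exists j s, [/\ j <= k0, block_start p n r j <= s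
     <= legendre p n r + j * geom_sum p n,
    l + (p - 1) * s + r = k0 + (p - 1) * legendre p n r & k0 <= 2 * l + j].
Proof.
move=> p_gt1 rN; rewrite sum_of_generatorsP //.
have geomN : (p - 1) * geom_sum p n = (p ^ n.+1 - 2) + 1.
  have := geom_sumE p n (ltnW p_gt1); lia.
have endj j := block_end p n r j p_gt1.
split.
- move=> [k [v [e [yE ele lv kl]]]].
  have kk0 : k <= k0.
    rewrite leqNgt; apply/negP => k0k.
    have : k0.+1 * (p ^ n.+1 - 2) <= k * (p ^ n.+1 - 2).
      by rewrite leq_mul2r k0k orbT.
    lia.
  have kN : k * (p ^ n.+1 - 2) <= k0 * (p ^ n.+1 - 2).
    by rewrite leq_mul2r kk0 orbT.
  have vE : v = r + (k0 - k) * (p ^ n.+1 - 2) by rewrite mulnBl; lia.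
  exists (k0 - k), (legendre p n r + (k0 - k) * geom_sum p n - e).
  have := endj (k0 - k); rewrite -vE => endk.
  split; try lia.
  have : (p - 1) * ((k0 - k) * geom_sum p n) =
      (k0 - k) * (p ^ n.+1 - 2) + (k0 - k).
    by rewrite mulnCA geomN mulnDr muln1.
  rewrite (mulnBr (p - 1) _ e) mulnDr.
  have : (p - 1) * e <= (p - 1) * (legendre p n r + (k0 - k) * geom_sum p n).
    by rewrite leq_mul2l; lia.
  rewrite mulnDr; lia.
- move=> [j [s [jk0 /andP[js sj] ls kl]]].
  exists (k0 - j), (r + j * (p ^ n.+1 - 2)).
  exists (legendre p n r + j * geom_sum p n - s).
  have endk := endj j.
  have jN : j * (p ^ n.+1 - 2) <= k0 * (p ^ n.+1 - 2).
    by rewrite leq_mul2r jk0 orbT.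
  split; try lia.
  + by rewrite mulnBl; lia.
  + have : (p - 1) * (j * geom_sum p n) = j * (p ^ n.+1 - 2) + j.
      by rewrite mulnCA geomN mulnDr muln1.
    have : (p - 1) * s <= (p - 1) * (legendre p n r + j * geom_sum p n).
      by rewrite leq_mul2l sj orbT.
    by rewrite (mulnBr (p - 1) _ s) mulnDr; lia.
Qed.

(** Let s < s' be the positions of consecutive lengths m > l, and suppose that
    s.+1 < s'.  Position s.+1 lies between the start of some block i and that
    of the block after it.  If block i extends to s.+1, then that position is
    only missing because of the condition k <= 2 l; but the later block of s'
    meets this condition, and going back to block i raises k by no more than
    it raises the length.  So s is the end of block i, which the next block
    fails to touch: this is the case v <= 1, where s = 0 and the next block
    starts at n.+1; by the same comparison of k with the length, that position
    belongs to a length. *)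
Lemma length_gaps (p n k0 r l m : nat) : 1 < p ->
  1 < p ^ n.+1 - 2 -> r < p ^ n.+1 - 2 ->
  let L := sum_of_length (generators p n.+1) (k0 * (p ^ n.+1 - 2) + r) in
  L l -> L m -> l < m -> (forall k, L k -> k <= l \/ m <= k) ->
  m - l = p - 1 \/ m - l = (p - 1) * n.+1.
Proof.
move=> p_gt1 N_gt1 rN L Ll Lm lm nob.
have LP k := sum_of_generators_blockP p n k0 r k p_gt1 rN.
have {Lm}[j [s [jk0 /andP[js sj] ms mj]]] := (LP m).1 Lm.
have {Ll}[j' [s' [jk0' /andP[js' sj'] ls lj']]] := (LP l).1 Ll.
have endj i := block_end p n r i p_gt1.
have gap := block_start_gap p n r.
have TS := block_startS p n r.
have T1 : r <= 1 -> block_start p n r 1 = n.+1.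
  move=> r1; rewrite /block_start big_ord1 mul0n addn0.
  by rewrite carry_loss_small // addn1.
have W0 : r <= 1 -> legendre p n r = 0 by exact: legendre_small.
have H_gt0 : 0 < geom_sum p n.
  by have := geom_sumE p n (ltnW p_gt1); case: (geom_sum p n) => //; lia.
move: (block_start p n r) (legendre p n r) (geom_sum p n) => T W H
  in gap js js' sj sj' ms ls endj TS T1 W0 H_gt0 LP *.
have d_gt0 : 0 < p - 1 by lia.
have lt_mul : (p - 1) * s < (p - 1) * s' by lia.
have ss' : s < s' by move: lt_mul; rewrite ltn_mul2l d_gt0.
have lm_s : m = l + (p - 1) * (s' - s) by rewrite mulnBr; lia.
case: (eqVneq s' s.+1) => [s'E|s'ne].
  by left; rewrite lm_s s'E; nia.
right.
have {s'ne} ss2 : s.+1 < s' by lia.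
(* positions strictly between s and s' would give lengths between l and m *)
have absent u i : s < u < s' -> i <= k0 -> T i <= u <= W + i * H ->
    k0 <= 2 * (l + (p - 1) * (s' - u)) + i -> False.
  move=> /andP[su us'] ik0 iu ki.
  have step a b : a < b -> (p - 1) * b = (p - 1) * a + (p - 1) * (b - a) /\
      0 < (p - 1) * (b - a).
    by move=> ab; rewrite -mulnDr subnKC ?muln_gt0 ?d_gt0 ?subn_gt0 // ltnW.
  have [su_step su_gt0] := step _ _ su.
  have [us'_step us'_gt0] := step _ _ us'.
  case: (nob (l + (p - 1) * (s' - u))); [|lia|lia].
  by apply/LP; exists i, u; split=> //; lia.
have Tj' : s.+1 < T j'.
  rewrite ltnNge; apply/negP => Tj's.
  apply: (absent s.+1 j') => //; first 2 last.
  - by rewrite (leq_trans lj') // leq_add2r leq_mul2l leq_addr.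
  - by rewrite ltnSn.
  - by rewrite Tj's; exact: leq_trans (ltnW ss2) sj'.
(* i is the last block that starts no later than position s.+1 *)
have exT : exists i, T i <= s.+1 by exists j; lia.
have bndT i : T i <= s.+1 -> i <= s.+1.
  by move=> Ti; have := gap 0 i (leq0n i); lia.
case: (ex_maxnP exT bndT) => i Ti imax.
have ji : j <= i by apply: imax; lia.
have Ti1 : s.+1 < T i.+1 by rewrite ltnNge; apply/negP => /imax; rewrite ltnn.
have ij' : i < j'.
  rewrite ltnNge; apply/negP => /(gap _ _); lia.
have gapj' := gap _ _ ij'.
have Hji : j * H <= i * H by rewrite leq_mul2r ji orbT.
case: (leqP s.+1 (W + i * H)) => si.
  case: (absent s.+1 i); rewrite ?ltnSn ?Ti //; first by lia.
  have : s' - s.+1 <= (p - 1) * (s' - s.+1) by rewrite leq_pmull.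
  by lia.
have {ji} ijE : i = j.
  apply/eqP; rewrite eqn_leq ji andbT -(leq_pmul2r H_gt0); lia.
subst i.
have CE : legendre p n (r + j * (p ^ n.+1 - 2)) <
          carry_loss p n (r + j * (p ^ n.+1 - 2)).
  have := endj j; move: Ti1; rewrite TS; lia.
have v_le1 : r + j * (p ^ n.+1 - 2) <= 1.
  rewrite leqNgt; apply/negP => /(carry_loss_le_legendre p n _ (ltnW p_gt1)).
  by rewrite leqNgt CE.
have j0 : j = 0 by case: (j) v_le1 => // i; rewrite mulSn; lia.
have r1 : r <= 1 by lia.
have {}W0 := W0 r1; have {}T1 := T1 r1.
have s0 : s = 0 by rewrite W0 j0 in sj; lia.
rewrite j0 T1 in gapj'; subst s.
have ns' : n.+1 <= s' by lia.
rewrite lm_s addKn subn0.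
case: (eqVneq s' n.+1) => [->//|s'n].
case: (absent n.+1 1); [lia|lia| |].
  by have := endj 1; rewrite T1 leqnn mul1n; lia.
have : s' - n.+1 <= (p - 1) * (s' - n.+1) by rewrite leq_pmull.
by lia.
Qed.

(** * The semigroup and its atoms *)

(** This is where p = x = 2 has to be excluded: there the largest generator is
    2 * 2 + 2, a multiple of the smallest. *)
Lemma pow_lt_generator (p n : nat) : 1 < p -> 0 < n -> (p, n.+1) <> (2, 2) ->
  p ^ n < p ^ n.+1 - 2.
Proof.
move=> p_gt1 n_gt0 pn; rewrite expnS.
case: n n_gt0 pn => // n _ pn.
have pn_gt0 : 0 < p ^ n by rewrite expn_gt0 ltnW.
rewrite expnS; case: (ltnP 2 p) => [p_gt2|p_le2]; first by nia.
have {p_gt1 p_le2} p2 : p = 2 by lia.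
case: n pn pn_gt0 => [|n]; rewrite p2 // => _ _.
have : 0 < 2 ^ n by rewrite expn_gt0.
rewrite expnS; lia.
Qed.

Lemma generators_pos (p n z : nat) : 2 < p ^ n.+1 ->
  z \in generators p n.+1 -> 0 < z.
Proof. by move=> q_gt2 /in_generators[->|[i _ ->]]; lia. Qed.

Lemma length_le (p n y l : nat) : 2 < p ^ n.+1 ->
  sum_of_length (generators p n.+1) y l -> l <= y.
Proof.
move=> q_gt2 [s [sG <- <-]]; elim: s sG => // z s IHs sG /=.
have z_gt0 := generators_pos _ _ _ q_gt2 (sG z (mem_head _ _)).
rewrite -add1n leq_add // IHs // => w ws; by apply: sG; rewrite inE ws orbT.
Qed.

Lemma small_generated (p n y : nat) : generated_by (generators p n.+1) y ->
  [\/ y = 0, y = p ^ n.+1 - 2 | 2 * (p ^ n.+1 - 2) <= y].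
Proof.
move=> /generated_byP[_ [s [sG <- _]]]; elim: s sG => [|z s IHs] sG /=.
  by constructor 1.
have {}IHs : [\/ sumn s = 0, sumn s = p ^ n.+1 - 2
                | 2 * (p ^ n.+1 - 2) <= sumn s].
  by apply: IHs => w ws; apply: sG; rewrite inE ws orbT.
have /in_generators[->|[i _ ->]] := sG z (mem_head _ _); last first.
  by constructor 3; lia.
case: IHs => [->|->|?]; first by constructor 2; rewrite addn0.
  by constructor 3; lia.
by constructor 3; lia.
Qed.

(** The generators other than p ^ n.+1 - 2 lie strictly between 2 and 3 times
    that number, and a sum of two nonzero elements is either exactly 2 times or
    at least 3 times that number. *)
Lemma generators_atoms (p n g : nat) : 1 < p -> 2 < p ^ n.+1 ->
  p ^ n < p ^ n.+1 - 2 -> g \in generators p n.+1 ->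
  atom (generated_by (generators p n.+1)) g.
Proof.
move=> p_gt1 q_gt2 topN gG; split.
  by rewrite -lt0n; exact: generators_pos gG.
have g_small : g = p ^ n.+1 - 2 \/
    2 * (p ^ n.+1 - 2) < g < 3 * (p ^ n.+1 - 2).
  have /in_generators[->|[i ilen ->]] := gG; first by left.
  right; have : p ^ i <= p ^ n by rewrite leq_exp2l.
  have : 0 < p ^ i by rewrite expn_gt0 ltnW.
  by lia.
by move=> a b /small_generated[] Ea /small_generated[] Eb abg; lia.
Qed.

Lemma card_generators (p n : nat) : 1 < p -> 2 < p ^ n.+1 ->
  #|` generators p n.+1| = n.+2.
Proof.
move=> p_gt1 q_gt2; rewrite /generators cardfsU1 card_in_imfset /=; last first.
  move=> i j /=; rewrite !(mem_iota 1 n.+1) => ilt jlt /addnI.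
  by move/eqP; rewrite eqn_exp2l // => /eqP; lia.
have -> : (p ^ n.+1 - 2 \in
    [fset (2 * (p ^ n.+1 - 2) + p ^ (i - 1))%N | i in iota 1 n.+1]%fset)
    = false.
  apply/negP => /imfsetP[i /= _].
  have : 0 < p ^ (i - 1) by rewrite expn_gt0 ltnW.
  by lia.
by rewrite mem_iota undup_id ?iota_uniq //= size_iota.
Qed.

(** With N = p ^ n.+1 - 2, an element y = k N + r with k >= 2 r is obtained from
    r copies of 2 N + 1 and k - 2 r copies of N. *)
Lemma generators_semigroup (p n : nat) : 1 < p -> 2 < p ^ n.+1 ->
  numerical_semigroup (generated_by (generators p n.+1)).
Proof.
move=> p_gt1 q_gt2; split.
- exact: generated_by0.
- exact: generated_byD.
set N := p ^ n.+1 - 2.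
apply: (@sub_finite_set _ _ `I_(2 * N * N)) (finite_II _) => y /= yS.
rewrite ltnNge; apply/negP => yN; apply: yS; apply/generated_byP.
have N_gt0 : 0 < N by rewrite /N; lia.
exists (y %/ N - y %% N); apply/sum_of_generatorsP => //.
exists (y %/ N), (y %% N), 0; rewrite -/N muln0 -divn_eq.
have := ltn_pmod y N_gt0; have : 2 * N <= y %/ N by rewrite leq_divRL.
by move=> ? ?; split=> //; lia.
Qed.

(** * The two gaps occur *)

(** All generators are congruent to -1 modulo p - 1. *)
Lemma dvdn_length_add (p n y l : nat) : 1 < p -> 2 < p ^ n.+1 ->
  sum_of_length (generators p n.+1) y l -> p - 1 %| l + y.
Proof.
move=> p_gt1 q_gt2 /sum_of_generatorsP -/(_ p_gt1)[k [v [e [-> _ lv _]]]].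
apply/dvdnP; exists (k * geom_sum p n + e).
have geomN : (p - 1) * geom_sum p n = (p ^ n.+1 - 2) + 1.
  by have := geom_sumE p n (ltnW p_gt1); lia.
by rewrite (mulnC _ (p - 1)) mulnDr mulnCA geomN mulnDr; lia.
Qed.

(** The element is p (2 N + 1) = (2 N + p) + (2 p - 2) N for N = p ^ n.+1 - 2;
    the congruence modulo p - 1 leaves no room between the two lengths. *)
Lemma small_gap_attained (p n : nat) : 1 < p -> 2 < p ^ n.+1 -> 0 < n ->
  let L := sum_of_length (generators p n.+1) (2 * p * (p ^ n.+1 - 2) + p) in
  [/\ L p, L (2 * p - 1) & forall k, L k -> k <= p \/ 2 * p - 1 <= k].
Proof.
move=> p_gt1 q_gt2 n_gt0 L.
have Lp : L p.
  apply/sum_of_generatorsP => //; exists (2 * p), p, 0; split=> //; lia.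
split=> //.
  apply/sum_of_generatorsP => //; exists (2 * p), p, 1; split=> //; try lia.
  by case: (n) n_gt0 => // n' _; rewrite legendreS divnn (ltnW p_gt1).
move=> k Lk; case: (leqP k p) => kp; [by left|right].
have := dvdn_length_add _ _ _ _ p_gt1 q_gt2 Lp.
have := dvdn_length_add _ _ _ _ p_gt1 q_gt2 Lk.
move=> /dvdn_sub/[apply]; rewrite subnDr => /dvdn_leq.
by rewrite subn_gt0 kp => /(_ isT); lia.
Qed.

(** For a multiple of N = p ^ n.+1 - 2 the first block is the single position 0
    and the second starts at n.+1.  With k0 = 2 D the length l = D of
    position n.+1 just satisfies k0 <= 2 l, hence also the weaker condition of
    the second block. *)
Lemma large_gap_attained (p n : nat) : 1 < p -> 2 < p ^ n.+1 ->
  let D := (p - 1) * n.+1 in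
  let L := sum_of_length (generators p n.+1) (2 * D * (p ^ n.+1 - 2)) in
  [/\ L D, L (2 * D) & forall k, L k -> k <= D \/ 2 * D <= k].
Proof.
move=> p_gt1 q_gt2 D L.
have LP l := sum_of_generators_blockP p n (2 * D) 0 l p_gt1.
rewrite addn0 in LP.
have {}LP l : L l <-> _ := LP l (ltac:(lia)).
have T1 : block_start p n 0 1 = n.+1.
  by rewrite /block_start big_ord1 mul0n addn0 carry_loss_small // addn1.
have W0 : legendre p n 0 = 0 by rewrite legendre_small.
have D_gt0 : 0 < D by rewrite muln_gt0; lia.
split.
- apply/LP; exists 1, n.+1; have := block_end p n 0 1 p_gt1.
  rewrite T1 W0 -/D => H1; split; lia.
- apply/LP; exists 0, 0; rewrite W0 /block_start big_ord0; split; lia.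
- move=> k /LP[[|j] [s [_ /andP[js sj] ks _]]].
    by right; rewrite W0 in sj ks; have s0 : s = 0 by [lia]; subst s; lia.
  left; have := block_start_gap p n 0 1 j.+1 isT; rewrite T1 => gap1.
  have : D <= (p - 1) * s by rewrite leq_mul2l; lia.
  by rewrite W0 in ks; lia.
Qed.

(** * The delta set *)

Theorem theorem5 (p x : nat) (hp : 2 <= p) (hx : 2 <= x)
    (hpx : (p, x) <> (2, 2)) :
  let S := generated_by (generators p x) in
  [/\ numerical_semigroup S,
      minimal_generating_set S (generators p x),
      #|` generators p x| = x + 1 &
      delta_set S = [set p - 1; (p - 1) * x]].
Proof.
case: x hx hpx => // n n_gt0 hpx S.
have topN := pow_lt_generator _ _ hp n_gt0 hpx.
have pn_gt0 : 0 < p ^ n by rewrite expn_gt0 ltnW.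
have q_gt2 : 2 < p ^ n.+1 by lia.
have atoms g := generators_atoms p n g hp q_gt2 topN.
have LE y := length_set_atoms _ y atoms.
have Lbound y l : length_set S y l -> l <= y by rewrite LE; exact: length_le.
have deltaI y l m : sum_of_length (generators p n.+1) y l ->
    sum_of_length (generators p n.+1) y m -> l < m ->
    (forall k, sum_of_length (generators p n.+1) y k -> k <= l \/ m <= k) ->
    delta_set S (m - l).
  move=> Ll Lm lm nob; exists y; first by apply/generated_byP; exists l.
  by apply/(delta_set_ofP _ _ _ _ (Lbound y)); exists l, m; rewrite LE.
split.
- exact: generators_semigroup.
- exact/minimal_generating_set_atoms.
- by rewrite card_generators // addn1.
- apply/seteqP; split=> d /=.
  + move=> [y _ /(delta_set_ofP _ _ _ _ (Lbound y))[l [m []]]].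
    rewrite LE /= => Ll Lm lm -> nob.
    rewrite (divn_eq y (p ^ n.+1 - 2)) in Ll Lm nob.
    apply: length_gaps Ll Lm lm nob => //; first by lia.
    by rewrite ltn_mod; lia.
  + case=> ->.
    * have [Ll Lm nob] := small_gap_attained p n hp q_gt2 n_gt0.
      have <- : 2 * p - 1 - p = p - 1 by lia.
      by apply: deltaI Ll Lm _ nob; lia.
    * have [Ll Lm nob] := large_gap_attained p n hp q_gt2.
      have D_gt0 : 0 < (p - 1) * n.+1 by rewrite muln_gt0; lia.
      have <- : 2 * ((p - 1) * n.+1) - (p - 1) * n.+1 = (p - 1) * n.+1 by lia.
      by apply: deltaI Ll Lm _ nob; lia.
Qed.
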